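(* Let $n, m_1, m_2$ be pairwise coprime positive integers such that $\{\log_2 m_i\} + \{\log_2 n\} \ge 1$ for each $i \in \{1,2\}$ and $\{\log_2 m_1\} + \{\log_2 m_2\} + 2\{\log_2 n\} < 3$. Then \[ \mathsf{D}^{\ast}_{\pm}(C_n \oplus C_{n m_1 m_2}) = \mathsf{D}_{\pm}(C_n \oplus C_{n m_1 m_2}) = \lfloor \log_2 (n^2 m_1 m_2) \rfloor + 1. \]
   Context: $C_m$ denotes a cyclic group of order $m$; $\{x\} = x - \lfloor x\rfloor$ is the fractional part. For a finite abelian group $G$ (written additively), $\mathsf{D}_{\pm}(G)$ is the smallest positive integer $\ell$ such that for every sequence $g_1,\dots,g_k$ of elements of $G$ (repetitions allowed) with $k \ge \ell$ there exist a non-empty subset $I \subset \{1,\dots,k\}$ and $a_i \in \{+1,-1\}$ ($i\in I$) with $\sum_{i \in I} a_i g_i = 0$. Further, $\mathsf{D}^{\ast}_{\pm}(G) = \max\{ \sum_{i=1}^t \lfloor \log_2 m_i \rfloor + 1 \colon G \cong \bigoplus_{i=1}^t C_{m_i},\ t, m_i \in \mathbb{N} \}$. *)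

(* Defs.v *)
From HB Require Import structures.
From mathcomp Require Import all_boot all_order all_algebra all_fingroup all_solvable.
From mathcomp Require Import boolp reals exp.

Set Implicit Arguments.
Unset Strict Implicit.
Unset Printing Implicit Defensive.

Import Order.TTheory GRing.Theory Num.Theory.
Local Open Scope ring_scope.

(* Provides the (componentwise) finZmodType structure on U * V. *)
HB.saturate prod.

Definition log2 {R : realType} (x : R) : R := ln x / ln 2.

Definition fracpart {R : realType} (x : R) : R := x - (Num.floor x)%:~R.

(* Cyclic of order m only for 0 < m; 'Z_m is not used since 'Z_1 has order 2. *)
Definition Cyc (m : nat) : finZmodType := 'I_m.-1.+1.

Definition plus_minus_zero_sum (G : finZmodType) (k : nat) (g : 'I_k -> G) : Prop :=
  exists (I : {set 'I_k}) (a : 'I_k -> int),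
    [/\ I != set0,
        (forall i, i \in I -> a i = 1 \/ a i = -1)
      & \sum_(i in I) g i *~ a i = 0].

Definition Dpm_bound (G : finZmodType) (l : nat) : Prop :=
  (0 < l)%N /\
  forall (k : nat) (g : 'I_k -> G), (l <= k)%N -> plus_minus_zero_sum g.

Lemma Dpm_bound_card (G : finZmodType) : Dpm_bound G #|G|.
Proof.
split=> [|k g leGk]; first by apply/card_gt0P; exists 0.
pose S (j : 'I_k.+1) := \sum_(i < k | (i < j)%N) g i.
have /injectivePn[x [y neq_xy eqS]] : ~~ injectiveb S.
  apply/negP => /injectiveP/leq_card; rewrite card_ord => leG.
  by move: (leq_trans leG leGk); rewrite ltnn.
wlog lt_xy : x y neq_xy eqS / (x < y)%N.
  move=> W; case: (ltngtP x y) => [|lt_yx|eq_xy]; first exact: (W x y).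
    by apply: (W y x) => //; rewrite eq_sym.
  by case/eqP: neq_xy; apply: val_inj.
exists [set i : 'I_k | (x <= i < y)%N], (fun=> 1); split.
- have lt_xk : (x < k)%N by rewrite (leq_trans lt_xy) // -ltnS ltn_ord.
  by apply/set0Pn; exists (Ordinal lt_xk); rewrite inE /= leqnn.
- by left.
- have: S y - S x = 0 by rewrite eqS subrr.
  rewrite /S (bigID (fun i : 'I_k => (i < x)%N)) /=.
  rewrite (eq_bigl (fun i : 'I_k => (i < x)%N)); last first.
    by move=> i; case: (ltnP i x) => [/ltn_trans->|]; rewrite ?andbF.
  rewrite addrAC subrr add0r => sum0; rewrite -[RHS]sum0.
  by apply: eq_big => [i|i _]; rewrite ?inE -?leqNgt 1?andbC.
Qed.

Lemma Dpm_subproof (G : finZmodType) : exists l, `[< Dpm_bound G l >].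
Proof. by exists #|G|; apply/asboolP; exact: Dpm_bound_card. Qed.

Definition Dpm (G : finZmodType) : nat := ex_minn (Dpm_subproof G).

(* The dependent finite functions carry the external direct product group law;
   G is regarded as a (multiplicatively written) group through its addition. *)
Definition Dpmstar_value (R : realType) (G : finZmodType) (l : nat) : Prop :=
  exists (t : nat) (m : 'I_t -> nat),
    [/\ (0 < t)%N,
        (forall i, 0 < m i)%N,
        [set: G] \isog [set: {dffun forall i : 'I_t, Cyc (m i)}]
      & l%:Z = \sum_(i < t) Num.floor (log2 (m i)%:R : R) + 1].

Lemma card_dsum_Cyc (t : nat) (m : 'I_t -> nat) : (forall i, 0 < m i)%N ->
  #|[set: {dffun forall i : 'I_t, Cyc (m i)}]| = (\prod_i m i)%N.
Proof.
move=> m_gt0; rewrite cardsT card_dep_ffun foldrE big_map big_enum /=.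
by apply: eq_bigr => i _; rewrite card_ord prednK.
Qed.

Lemma log2_prod (R : realType) (t : nat) (m : 'I_t -> nat) :
  (forall i, 0 < m i)%N ->
  log2 (\prod_i m i)%N%:R = \sum_i log2 (m i)%:R :> R.
Proof.
move=> m_gt0; rewrite natr_prod.
pose K (x y : R) := 0 < x /\ log2 x = y.
suff [] : K (\prod_i (m i)%:R) (\sum_i log2 (m i)%:R) by [].
apply: (big_ind2 K) => [|x1 x2 y1 y2 [x1_gt0 <-] [y1_gt0 <-]|i _].
- by split=> //; rewrite /log2 ln1 mul0r.
- split; first by rewrite mulr_gt0.
  by rewrite /log2 lnM ?posrE // mulrDl.
- by split=> //; rewrite ltr0n.
Qed.

Lemma Dpmstar_value_bounded (R : realType) (G : finZmodType) (l : nat) :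
  `[< Dpmstar_value R G l >] ->
  (l <= `|(Num.floor (log2 #|G|%:R : R) + 1)%R|)%N.
Proof.
move=> /asboolP[t [m [_ m_gt0 isoG def_l]]].
have cardG : #|G| = (\prod_i m i)%N.
  by rewrite -card_dsum_Cyc // -(card_isog isoG) cardsT.
suff: (l%:Z <= Num.floor (log2 #|G|%:R : R) + 1).
  by case: (Num.floor _ + 1) => // k; rewrite lez_nat.
rewrite def_l lerD2r floor_ge_int cardG log2_prod // rmorph_sum /=.
by apply: ler_sum => i _; rewrite floor_le.
Qed.

Lemma isog_dsum_Cyc (G : finZmodType) (t : nat) (e : 'I_t -> G) :
  \big[dprod/1%g]_(i < t) <[e i]>%g = [set: G] ->
  [set: G] \isog [set: {dffun forall i : 'I_t, Cyc #[e i]%g}].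
Proof.
move=> defG; pose gT := {dffun forall i : 'I_t, Cyc #[e i]%g}.
have o_gt0 i : (0 < #[e i]%g)%N by exact: order_gt0.
pose f (x : gT) : G := (\prod_i e i ^+ (x i : nat))%g.
have fM : {in [set: gT] &, {morph f : x y / (x * y)%g >-> (x * y)%g}}.
  move=> x y _ _; rewrite /f -[RHS]/(_ + _) -big_split /=.
  apply: eq_bigr => i _; rewrite ffunE -[RHS]/(_ * _)%g -expgD.
  rewrite -[RHS]expg_mod_order; congr (_ ^+ _)%g.
  by rewrite /=; congr (_ %% _)%N; rewrite prednK.
pose fm := Morphism fM.
rewrite isogEcard (card_dsum_Cyc (m := fun i => #[e i]%g)) //.
rewrite -(bigdprod_card defG) leqnn andbT.
apply/homgP; exists fm; apply/setP=> z; rewrite inE.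
have [c [c_in -> _]] := mem_bigdprod defG (in_setT z).
have /fin_all_exists[k def_c] i : exists k : Cyc #[e i]%g, c i = (e i ^+ k)%g.
  have /cycleP[n ->] := c_in i isT.
  exists (inord (n %% #[e i]%g)); rewrite inordK ?expg_mod_order //.
  by rewrite prednK // ltn_mod.
apply/morphimP; exists [ffun i => k i]; rewrite ?in_setT //.
by apply: eq_bigr => i _; rewrite ffunE def_c.
Qed.

Lemma Dpmstar_subproof (R : realType) (G : finZmodType) :
  exists l, `[< Dpmstar_value R G l >].
Proof.
have [b defG _] := abelian_structure (FinRing.Theory.zmod_abelian [set: G]).
pose e i := tnth (in_tuple (1%g :: b)) i.
have defG1 : \big[dprod/1%g]_(i < (size b).+1) <[e i]>%g = [set: G].
  transitivity (\big[dprod/1%g]_(x <- 1%g :: b) <[x]>%g).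
    by rewrite [RHS]big_tnth.
  by rewrite big_cons cycle1 dprod1g.
pose v := \sum_(i < (size b).+1) Num.floor (log2 #[e i]%g%:R : R) + 1.
have v_ge0 : 0 <= v.
  apply: addr_ge0 => //; apply: sumr_ge0 => i _.
  by rewrite floor_ge0 /log2 divr_ge0 ?ln_ge0 // ler1n ?order_gt0.
exists `|v|%N; apply/asboolP; exists (size b).+1, (fun i => #[e i]%g); split=> //.
- exact: isog_dsum_Cyc.
- by rewrite gez0_abs.
Qed.

Definition Dpmstar (R : realType) (G : finZmodType) : nat :=
  ex_maxn (Dpmstar_subproof R G) (@Dpmstar_value_bounded R G).

(* Main.v *)
(* Pigeonhole on the 2^k subset sums gives Dpm G <= floor (log2 |G|) + 1, and
   sequences of binary powers of generators give Dpmstar G <= Dpm G.  The two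
   bounds meet here because C_n + C_(n m1 m2) = C_(n m1) + C_(n m2): the
   hypotheses make one carry occur in each log2 (n m_i), and exactly two in
   log2 (n^2 m1 m2). *)

From HB Require Import structures.
Require Import Defs.
From mathcomp Require Import all_boot all_order all_algebra.
From mathcomp Require Import all_fingroup all_solvable zify lra.
From mathcomp Require Import boolp exp.
From mathcomp Require Import reals.
Import Order.TTheory GRing.Theory Num.Theory.
Local Open Scope ring_scope.

(** * Floors of base-two logarithms *)

Lemma floor_log2 (R : realType) (m : nat) : (0 < m)%N ->
  Num.floor (log2 m%:R : R) = (trunc_log 2 m)%:Z.
Proof.
move=> m_gt0; have ln2_gt0 : 0 < ln 2 :> R by rewrite ln_gt0 // ltr1n.
have lnX k : ln (2 ^ k)%N%:R = k%:R * ln 2 :> R.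
  by rewrite natrX lnXn // mulr_natl.
have /andP[le_m lt_m] := trunc_log_bounds (isT : 1 < 2)%N m_gt0.
apply: floor_def; rewrite /log2 ler_pdivlMr // ltr_pdivrMr //.
rewrite -[_ + 1]/((trunc_log 2 m)%:Z + 1%:Z) -PoszD addn1 -!pmulrn -!lnX.
rewrite ler_ln ?ltr_ln ?posrE ?ltr0n ?expn_gt0 //.
by rewrite ler_nat ltr_nat le_m.
Qed.

Lemma log2M (R : realType) (x y : R) : 0 < x -> 0 < y ->
  log2 (x * y) = log2 x + log2 y.
Proof. by move=> x0 y0; rewrite /log2 lnM ?posrE // mulrDl. Qed.

(** * Signed binary expansions, over the integers and in cyclic groups *)

Section SignedBinary.
Variable a : nat -> int.
Hypothesis a_le1 : forall j, `|a j| <= 1.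

Lemma ltr_norm_sum_pow2 (k : nat) : `|\sum_(j < k) 2 ^+ j * a j| < 2 ^+ k.
Proof.
elim: k => [|k IHk]; first by rewrite big_ord0.
rewrite big_ord_recr /= (le_lt_trans (ler_normD _ _)) //.
rewrite exprS mulr_natl mulr2n ltr_leD // normrM normrX.
by rewrite -[leRHS]mulr1 ler_pM2l ?exprn_gt0.
Qed.

(** The lower terms add up to less than [2 ^+ k] in absolute value, so they cannot cancel a nonzero
    top term; descend on [k]. *)
Lemma sum_pow2_eq0 (k : nat) : \sum_(j < k) 2 ^+ j * a j = 0 ->
  forall j, (j < k)%N -> a j = 0.
Proof.
elim: k => [|k IHk] //; rewrite big_ord_recr /= => /eqP sum0.
have ak0 : a k = 0.
  have := ltr_norm_sum_pow2 k.
  move: sum0; rewrite addr_eq0 => /eqP->; rewrite normrN normrM normrX.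
  by rewrite gtr_pMr ?exprn_gt0 //; lia.
move: sum0; rewrite ak0 mulr0 addr0 => /eqP/IHk a0 j.
by rewrite ltnS leq_eqVlt => /predU1P[->|/a0].
Qed.

End SignedBinary.

(** [inZp] reduces modulo the order, so the trivial group gets 0 as its generator. *)
Definition Cyc_gen (m : nat) : Cyc m := inZp 1.

Lemma Cyc_gen_mulrn_eq0 (m k : nat) : (0 < m)%N ->
  (Cyc_gen m *+ k == 0) = (m %| k)%N.
Proof.
move=> m_gt0; rewrite Zp_mulrn -val_eqE /= modnMml mul1n /dvdn.
by rewrite prednK.
Qed.

Lemma Cyc_gen_mulrz_eq0 (m : nat) (z : int) : (0 < m)%N ->
  (Cyc_gen m *~ z == 0) = (m %| `|z|)%N.
Proof.
move=> m_gt0; case: z => k; first by rewrite -pmulrn Cyc_gen_mulrn_eq0.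
by rewrite NegzE mulrNz oppr_eq0 -pmulrn Cyc_gen_mulrn_eq0.
Qed.

(** The sum is [s] times the generator for an integer [s] with |s| < 2^k <= m. Since m divides s, s
    = 0 already over the integers. *)
Lemma Cyc_signed_pow2_eq0 (m k : nat) (c : 'I_k -> int) :
  (2 ^ k <= m)%N -> (forall j, `|c j| <= 1) ->
  \sum_(j < k) Cyc_gen m *+ 2 ^ j *~ c j = 0 -> forall j, c j = 0.
Proof.
move=> le_km c_le1.
have m_gt0 : (0 < m)%N by rewrite (leq_trans _ le_km) ?expn_gt0.
pose a (j : nat) := if insub j is Some i then c i else 0.
have aE (j : 'I_k) : a j = c j.
  by rewrite /a insubT //= => lt_jk; congr c; apply: val_inj.
have a_le1 j : `|a j| <= 1 by rewrite /a; case: insub.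
move=> /eqP sum0 j.
have [lt_jk eq_cj] : (j < k)%N /\ c j = a j by rewrite aE.
rewrite eq_cj; apply: sum_pow2_eq0 lt_jk => //.
set s := \sum_(_ < k) _; have : Cyc_gen m *~ s == 0.
  rewrite mulrz_sumr; move: sum0; congr (_ == 0); apply: eq_bigr => i _.
  by rewrite mulrzA aE -natrX natz -pmulrn.
rewrite Cyc_gen_mulrz_eq0 // => dvd_ms.
have lt_sm : (`|s| < m)%N.
  by rewrite (leq_trans _ le_km) // -ltz_nat abszE -natz natrX ltr_norm_sum_pow2.
apply/eqP; rewrite -absz_eq0.
case: `|s|%N dvd_ms lt_sm => // u /(dvdn_leq (ltn0Sn u)).
by rewrite ltnNge => ->.
Qed.

(** * Lower and upper bounds for [Dpm] *)

Lemma DpmP (G : finZmodType) : Dpm_bound G (Dpm G).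
Proof. by rewrite /Dpm; case: ex_minnP => l /asboolP. Qed.

Lemma Dpm_le (G : finZmodType) (l : nat) : Dpm_bound G l -> (Dpm G <= l)%N.
Proof. by move=> Gl; rewrite /Dpm; case: ex_minnP => k _; apply; apply/asboolP. Qed.

(** Coefficients in {-1, 0, 1} encode a subset together with its signs, so [g], enumerated as a
    sequence of length [#|J|], has no vanishing signed subsum. *)
Lemma card_lt_Dpm (G : finZmodType) (J : finType) (g : J -> G) :
  (forall c : J -> int, (forall j, `|c j| <= 1) ->
    \sum_j g j *~ c j = 0 -> forall j, c j = 0) ->
  (#|J| < Dpm G)%N.
Proof.
move=> free_g; rewrite ltnNge; apply/negP => /((DpmP G).2 #|J| (g \o enum_val)).
move=> [I [a [/set0Pn[i iI] aP sum0]]].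
pose c j := if enum_rank j \in I then a (enum_rank j) else 0.
have /free_g cP : forall j, `|c j| <= 1.
  by move=> j; rewrite /c; case: ifP => // /aP[] ->.
suff /cP/(_ (enum_val i)) : \sum_j g j *~ c j = 0.
  by rewrite /c enum_valK iI => ai0; case: (aP i iI); rewrite ai0.
rewrite -[RHS]sum0 (reindex (@enum_val J predT)) /=; last first.
  exact/onW_bij/enum_val_bij.
rewrite [RHS]big_mkcond; apply: eq_bigr => j _.
by rewrite /c enum_valK; case: ifP.
Qed.

(* Two distinct subsets with equal sums cancel on their symmetric difference. *)
Lemma Dpm_le_trunc_log (G : finZmodType) : (Dpm G <= (trunc_log 2 #|G|).+1)%N.
Proof.
apply: Dpm_le; split=> // k g le_k.
pose f (S : {set 'I_k}) := \sum_(i in S) g i.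
have /injectivePn[S [T neqST eq_f]] : ~~ injectiveb f.
  (* There are 2^k subsets, and k > [trunc_log 2 #|G|] gives 2^k > |G|. *)
  apply/negP => /injectiveP/leq_card; rewrite -cardsT -powersetT card_powerset.
  rewrite cardsT card_ord leqNgt.
  by rewrite (leq_trans (trunc_log_ltn _ (isT : 1 < 2)%N)) // leq_exp2l.
exists ((S :\: T) :|: (T :\: S)), (fun i => if i \in S then 1 else -1); split.
- apply: contraNneq neqST => /eqP; rewrite setU_eq0 !setD_eq0.
  by rewrite eqEsubset.
- by move=> i _; case: ifP; [left | right].
- have: f S - f T = 0 by rewrite eq_f subrr.
  rewrite /f big_mkcond [X in _ - X]big_mkcond -sumrB => sum0.
  rewrite big_mkcond -[RHS]sum0; apply: eq_bigr => i _; rewrite !inE.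
  by case: (i \in S); case: (i \in T); rewrite /= ?subrr ?subr0 ?sub0r.
Qed.

(* The elements 2^j e_i with 2^(j+1) <= m_i, for generators e_i of the cyclic
   summands, admit no vanishing signed subsum: read off the i-th coordinate. *)
Lemma Dpmstar_value_le_Dpm (R : realType) (G : finZmodType) (l : nat) :
  Dpmstar_value R G l -> (l <= Dpm G)%N.
Proof.
move=> [t [m [_ m_gt0 /isogP[f injf imf] def_l]]].
pose K i := trunc_log 2 (m i); pose J := {i : 'I_t & 'I_(K i)}.
have -> : l = #|{: J}|.+1.
  apply/eqP; rewrite -eqz_nat def_l -addn1 PoszD; apply/eqP; congr (_ + _).
  rewrite -sum1_card -[RHS]natz natr_sum.
  rewrite -(sig_big_dep xpredT (fun=> xpredT) (fun i (j : 'I_(K i)) => 1)) /=.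
  by apply: eq_bigr => i _; rewrite floor_log2 // sumr_const card_ord natz.
pose v (p : J) : {dffun forall i, Cyc (m i)} :=
  [ffun i => dfwith (fun i => 0 : Cyc (m i)) (Cyc_gen (m (tag p)) *+ 2 ^ tagged p) i].
have /fin_all_exists[g fg] p : exists x : G, f x = v p.
  have : v p \in (f @* [set: G])%g by rewrite imf inE.
  by case/morphimP=> x _ _ ->; exists x.
(* The group isomorphism [f] is multiplicative; its coordinates are repackaged as additive maps so
   that they commute with signed sums. *)
pose q i (x : G) : Cyc (m i) := f x i.
have qD i x y : q i (x + y) = q i x + q i y.
  by rewrite /q [f _]morphM ?inE // ffunE.
have qB i : zmod_morphism (q i).
  by move=> x y; apply: (addIr (q i y)); rewrite -qD !subrK.
pose qa i : {additive G -> Cyc (m i)} :=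
  HB.pack (q i) (GRing.isZmodMorphism.Build _ _ _ (qB i)).
apply: (@card_lt_Dpm _ _ g) => c c_le1 sum0 p.
have {sum0} : qa (tag p) (\sum_j g j *~ c j) = 0 by rewrite sum0 raddf0.
rewrite raddf_sum.
(* The sum over dependent pairs is split by summand [i]; in the coordinate [tag p] only the block
   [i = tag p] survives, a signed binary sum. *)
pose F i (j : 'I_(K i)) : Cyc (m (tag p)) :=
  dfwith (fun i => 0 : Cyc (m i)) (Cyc_gen (m i) *+ 2 ^ j) (tag p)
    *~ c (Tagged (fun i => 'I_(K i)) j).
rewrite (eq_bigr (fun j : J => F (tag j) (tagged j))) => [|j _]; last first.
  by rewrite raddfMz /= /q fg ffunE /F; case: j.
rewrite -(sig_big_dep xpredT (fun=> xpredT) F) /= (bigD1 (tag p)) //=.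
rewrite [X in _ + X]big1 => [|i ne_ip]; last first.
  by rewrite big1 // => j _; rewrite /F dfwith_out // mul0rz.
rewrite addr0 /F; under eq_bigr do rewrite dfwith_in.
clear F; case: p => i j /= /Cyc_signed_pow2_eq0; apply=> //.
by rewrite trunc_logP.
Qed.

(** * The second decomposition of the group, and carries in the logarithms *)

Lemma pairMn (U V : zmodType) (u : U) (v : V) (k : nat) :
  (u, v) *+ k = (u *+ k, v *+ k).
Proof. by elim: k => [|k IHk]; rewrite ?mulr0n // !mulrS IHk. Qed.

(** The factor m1 is moved to the first summand: [x] joins a generator of C_n to an element of order
    m1, coprime to n, while [y] generates the subgroup of order n m2 of the second summand. *)
Lemma dprod_cycles_Cyc (n m1 m2 : nat) :
  (0 < n)%N -> (0 < m1)%N -> (0 < m2)%N -> coprime m1 n -> coprime m1 m2 ->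
  let G : finZmodType := (Cyc n * Cyc (n * m1 * m2)%N)%type in
  exists x y : G,
    [/\ (<[x]> \x <[y]>)%g = [set: G],
        #[x]%g = (n * m1)%N & #[y]%g = (n * m2)%N].
Proof.
move=> n_gt0 m1_gt0 m2_gt0 co_m1n co_m1m2; set N := (n * m1 * m2)%N => G.
have N_gt0 : (0 < N)%N by rewrite !muln_gt0 n_gt0 m1_gt0.
pose x : G := (Cyc_gen n, Cyc_gen N *+ (n * m2)%N).
pose y : G := (0, Cyc_gen N *+ m1).
have xE k : (x ^+ k)%g = (Cyc_gen n *+ k, Cyc_gen N *+ (n * m2 * k)%N).
  by rewrite -[LHS]/(x *+ k) pairMn -mulrnA.
have yE k : (y ^+ k)%g = (0, Cyc_gen N *+ (m1 * k)%N).
  by rewrite -[LHS]/(y *+ k) pairMn mul0rn -mulrnA.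
have dvd_m1 k : (m1 %| n * m2 * k)%N = (m1 %| k)%N.
  by rewrite Gauss_dvdr // coprimeMr co_m1n.
have ox : #[x]%g = (n * m1)%N.
  have dvd_x k : (#[x]%g %| k)%N = (n * m1 %| k)%N.
    rewrite order_dvdn xE -[_ == 1%g]/((_ == 0) && (_ == 0)) !Cyc_gen_mulrn_eq0 //.
    by rewrite /N mulnAC dvdn_pmul2l ?muln_gt0 ?n_gt0 // Gauss_dvd // coprime_sym.
  by apply/eqP; rewrite eqn_dvd dvd_x dvdnn -dvd_x dvdnn.
have oy : #[y]%g = (n * m2)%N.
  have dvd_y k : (#[y]%g %| k)%N = (n * m2 %| k)%N.
    rewrite order_dvdn yE -[_ == 1%g]/((_ == 0) && (_ == 0)) eqxx !Cyc_gen_mulrn_eq0 //.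
    by rewrite /N mulnAC [(_ * m1)%N]mulnC dvdn_pmul2l.
  by apply/eqP; rewrite eqn_dvd dvd_y dvdnn -dvd_y dvdnn.
have tiXY : (<[x]> :&: <[y]> = 1)%g.
  apply/trivgP/subsetP => _ /setIP[/cycleP[k ->] /cycleP[l]].
  rewrite inE -order_dvdn ox xE yE => /pair_equal_spec[/eqP].
  (* For k x = l y, the first coordinate gives n | k. Multiplying the second by n m2, the order of
     [y], kills the right side and leaves m1 | k. *)
  rewrite Cyc_gen_mulrn_eq0 // => n_dvd_k /(congr1 (fun z => z *+ (n * m2))) /eqP.
  have -> : Cyc_gen N *+ (m1 * l) *+ (n * m2) = 0.
    by apply/eqP; rewrite -mulrnA Cyc_gen_mulrn_eq0 // /N; apply/dvdnP; exists l; lia.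
  rewrite -mulrnA Cyc_gen_mulrn_eq0 // /N mulnAC mulnC dvdn_pmul2r ?muln_gt0 ?n_gt0 //.
  by rewrite dvd_m1 => m1_dvd_k; rewrite Gauss_dvd 1?coprime_sym // n_dvd_k.
exists x, y; split=> //; rewrite dprodE //; last first.
  by rewrite (sub_abelian_cent2 (FinRing.Theory.zmod_abelian [set: G])) ?subsetT.
apply/eqP; rewrite eqEcard subsetT TI_cardMg // -!orderE ox oy cardsT card_prod !card_ord.
by rewrite !prednK // /N; lia.
Qed.

(** The two fractional parts add up to a number in [1, 2), hence exactly one carry. *)
Lemma floor_log2M (R : realType) (x y : R) : 0 < x -> 0 < y ->
  1 <= fracpart (log2 x) + fracpart (log2 y) ->
  Num.floor (log2 (x * y)) = Num.floor (log2 x) + Num.floor (log2 y) + 1.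
Proof.
move=> x_gt0 y_gt0; rewrite /fracpart log2M // => ge1.
have ltx := floorD1_gt (log2 x); have lty := floorD1_gt (log2 y).
by apply: floor_def; rewrite !intrD in ltx lty *; apply/andP; split; lra.
Qed.

Theorem theorem3p5 (R : realType) (n m1 m2 : nat)
    (n_gt0 : (0 < n)%N) (m1_gt0 : (0 < m1)%N) (m2_gt0 : (0 < m2)%N)
    (co_n_m1 : coprime n m1) (co_n_m2 : coprime n m2) (co_m1_m2 : coprime m1 m2)
    (frac1 : 1 <= fracpart (log2 (m1%:R : R)) + fracpart (log2 (n%:R : R)))
    (frac2 : 1 <= fracpart (log2 (m2%:R : R)) + fracpart (log2 (n%:R : R)))
    (frac12 : fracpart (log2 (m1%:R : R)) + fracpart (log2 (m2%:R : R))
                + 2 * fracpart (log2 (n%:R : R)) < 3) :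
  Dpmstar R (Cyc n * Cyc (n * m1 * m2)%N)%type
    = Dpm (Cyc n * Cyc (n * m1 * m2)%N)%type /\
  (Dpm (Cyc n * Cyc (n * m1 * m2)%N)%type)%:Z
    = Num.floor (log2 ((n ^ 2 * m1 * m2)%N%:R : R)) + 1.
Proof.
set G : finZmodType := (Cyc n * Cyc (n * m1 * m2)%N)%type.
have cardG : #|{: G}| = (n ^ 2 * m1 * m2)%N.
  by rewrite card_prod !card_ord !prednK ?muln_gt0 ?n_gt0 ?m1_gt0 //; lia.
have ord_gt0 : (0 < n ^ 2 * m1 * m2)%N by rewrite !muln_gt0 n_gt0 m1_gt0.
set L := (trunc_log 2 (n ^ 2 * m1 * m2)).+1.
have floor_ord : Num.floor (log2 ((n ^ 2 * m1 * m2)%N%:R : R)) + 1 = L%:Z.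
  by rewrite floor_log2 // /L -[in RHS]addn1 PoszD.
have floor_split : Num.floor (log2 ((n * m1)%N%:R : R))
    + Num.floor (log2 ((n * m2)%N%:R : R))
    = Num.floor (log2 ((n ^ 2 * m1 * m2)%N%:R : R)).
  have [rn r1 r2] : [/\ 0 < n%:R :> R, 0 < m1%:R :> R & 0 < m2%:R :> R].
    by rewrite !ltr0n.
  rewrite !(mulnC n) (natrM _ m1 n) (natrM _ m2 n) !floor_log2M //.
  (* The fractional parts of all four factors add up to a number in [2, 3): at least 2 by [frac1]
     and [frac2], below 3 by [frac12]. These two carries match the one carry in each n m_i. *)
  apply/esym/floor_def.
  rewrite !natrM !log2M ?mulr_gt0 //.
  move: frac1 frac2 frac12; rewrite /fracpart !intrD.
  by move=> *; apply/andP; split; lra.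
have L_value : Dpmstar_value R G L.
  have co_m1_n : coprime m1 n by rewrite coprime_sym.
  have [x [y [defG ox oy]]] :=
    dprod_cycles_Cyc _ _ _ n_gt0 m1_gt0 m2_gt0 co_m1_n co_m1_m2.
  pose e (i : 'I_2) : G := if i == ord0 then x else y.
  have def_e : \big[dprod/1%g]_(i < 2) <[e i]>%g = [set: G].
    by rewrite !big_ord_recl big_ord0 dprodg1.
  exists 2%N, (fun i => #[e i]%g); split; first by [].
  - by move=> i; apply: order_gt0.
  - exact: isog_dsum_Cyc def_e.
  - by rewrite !big_ord_recl big_ord0 addr0 /e ox oy floor_split floor_ord.
(* The chain L <= [Dpmstar] <= [Dpm] <= L closes the argument. *)
have Dpmstar_ge : (L <= Dpmstar R G)%N.
  by rewrite /Dpmstar; case: ex_maxnP => l _; apply; apply/asboolP.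
have Dpmstar_le : (Dpmstar R G <= Dpm G)%N.
  by rewrite /Dpmstar; case: ex_maxnP => l /asboolP/Dpmstar_value_le_Dpm.
have Dpm_le_L : (Dpm G <= L)%N by rewrite /L -cardG Dpm_le_trunc_log.
by rewrite floor_ord; split; first apply/eqP; lia.
Qed.
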